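(* Let $\mathcal{A}$ be a finite alphabet, let $\Omega\subseteq\mathcal{A}^{\mathbb{N}}$ be a shift space, let $l\ge 2$ be an integer, and let $\mathsf{X}_\Omega^{(l)}$ be the associated multiplicative subshift. The following are equivalent. (1) $\Omega$ is extensible. (2) $\mathsf{X}_\Omega^{(l)}$ is transitive. (3) For all $u,v\in B(\mathsf{X}_\Omega^{(l)})$ there exists $\alpha\in\mathbb{N}\setminus l\mathbb{N}$ such that for any $k\in\mathbb{N}_0$ there exists $x\in\mathsf{X}_\Omega^{(l)}$ such that $x|_{s(u)}=u$ and $(\Pi_{|u|\alpha l^k}x)|_{s(v)}=v$. (4) $\mathsf{X}_\Omega^{(l)}$ is $L$-directional mixing for some integer $L>1$ which has a prime factor $p$ satisfying $p\nmid l$. (5) $\mathsf{X}_\Omega^{(l)}$ is $L$-directional mixing for every integer $L>1$ which has a prime factor $p$ satisfying $p\nmid l$.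
   Context: $\mathbb{N}=\{1,2,\ldots\}$, $\mathbb{N}_0=\mathbb{N}\cup\{0\}$, and $[i,j]=\{n\in\mathbb{N}: i\le n\le j\}$. A shift space $\Omega\subseteq\mathcal{A}^{\mathbb{N}}$ (one-sided) is a closed set with $\sigma(\Omega)\subseteq\Omega$, where $(\sigma x)_i=x_{i+1}$. $B(\Omega)$ is the set of all admissible words of $\Omega$ (finite words of length $\ge 1$ occurring in elements of $\Omega$), and $|u|$ is the length of $u$. $\Omega$ is extensible if for all $u\in B(\Omega)$ and all $m\in\mathbb{N}$ there exists $x\in\Omega$ with $x_{[m+1,m+|u|]}=u$. The multiplicative subshift is $\mathsf{X}_\Omega^{(l)}=\{x=(x_k)_{k\ge1}\in\mathcal{A}^{\mathbb{N}} : (x_{i l^{n-1}})_{n\in\mathbb{N}}\in\Omega \text{ for all } i\in\mathbb{N}\}$. For $q\in\mathbb{N}$, $\Pi_q$ is defined by $(\Pi_q x)_i=x_{qi}$. $B(\mathsf{X}_\Omega^{(l)})$ is the set of admissible words $u=x|_{[1,n]}$ with $x\in\mathsf{X}_\Omega^{(l)}$ and $n\ge1$; here $|u|=n$ and the support of $u$ is $s(u)=[1,n]$. $\mathsf{X}_\Omega^{(l)}$ is transitive if for all $u,v\in B(\mathsf{X}_\Omega^{(l)})$ there exist $m\in\mathbb{N}$ and $x\in\mathsf{X}_\Omega^{(l)}$ such that $x|_{[1,|u|]}=u$ and $(\Pi_{|u|m}x)|_{[1,|v|]}=v$. For an integer $q>1$, $\mathsf{X}_\Omega^{(l)}$ is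 $q$-directional mixing if for all $u,v\in B(\mathsf{X}_\Omega^{(l)})$ there exists $k\in\mathbb{N}_0$ such that for any $\alpha\in\mathbb{N}\setminus q\mathbb{N}$ there exists $x\in\mathsf{X}_\Omega^{(l)}$ satisfying $x|_{s(u)}=u$ and $(\Pi_{|u|\alpha q^k}x)|_{s(v)}=v$. *)

(* Defs.v *)
From HB Require Import structures.
From mathcomp Require Import all_boot.
From mathcomp Require Import all_classical.
From mathcomp Require Import topology.

Set Implicit Arguments.
Unset Strict Implicit.
Unset Printing Implicit Defensive.

Local Open Scope classical_set_scope.

(* One-sided sequences (x_i)_{i >= 1} are functions nat -> A storing x_i at
   i - 1.  They are accessed only through [coord] and built only through
   [family1], so every index written below is 1-based; [coord x 0] is a junk
   value that never occurs, all indices in use being positive. *)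
Definition coord (A : Type) (x : nat -> A) (i : nat) : A := x i.-1.

Definition family1 (A : Type) (f : nat -> A) : nat -> A := fun j => f j.+1.

Definition shift (A : Type) (x : nat -> A) : nat -> A :=
  family1 (fun i => coord x i.+1).

(* x_{[i,j]} *)
Definition restr (A : Type) (x : nat -> A) (i j : nat) : seq A :=
  [seq coord x k | k <- index_iota i j.+1].

(* Closed for the product of the discrete topologies. *)
Definition shift_space (A : finType) (Omega : set (nat -> A)) : Prop :=
  closed (Omega : set {ptws nat -> discrete_topology A}) /\
  (@shift A) @` Omega `<=` Omega.

Definition admissible (A : Type) (Omega : set (nat -> A)) : set (seq A) :=
  [set u | (1 <= size u)%N /\
     exists x i, [/\ Omega x, (1 <= i)%N & restr x i (i + size u).-1 = u]].

Definition extensible (A : Type) (Omega : set (nat -> A)) : Prop :=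
  forall u m, admissible Omega u -> (1 <= m)%N ->
  exists2 x, Omega x & restr x m.+1 (m + size u) = u.

Definition mult_subshift (A : Type) (Omega : set (nat -> A)) (l : nat) :
    set (nat -> A) :=
  [set x | forall i, (1 <= i)%N ->
     Omega (family1 (fun n => coord x (i * l ^ (n - 1))))].

Definition Pi (A : Type) (q : nat) (x : nat -> A) : nat -> A :=
  family1 (fun i => coord x (q * i)).

(* Unlike [admissible], only the words u = x|_{[1,n]} are considered: the
   multiplicative subshift is not invariant under the shift. *)
Definition mult_admissible (A : Type) (X : set (nat -> A)) : set (seq A) :=
  [set u | exists x n, [/\ X x, (1 <= n)%N & u = restr x 1 n]].

Definition mult_transitive (A : Type) (X : set (nat -> A)) : Prop :=
  forall u v, mult_admissible X u -> mult_admissible X v ->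
  exists m x, [/\ (1 <= m)%N, X x, restr x 1 (size u) = u &
                  restr (Pi (size u * m) x) 1 (size v) = v].

Definition directional_mixing (A : Type) (X : set (nat -> A)) (q : nat) : Prop :=
  forall u v, mult_admissible X u -> mult_admissible X v ->
  exists k : nat, forall alpha, (1 <= alpha)%N -> ~~ (q %| alpha) ->
  exists x, [/\ X x, restr x 1 (size u) = u &
                restr (Pi (size u * alpha * q ^ k) x) 1 (size v) = v].

(* Main.v *)
(* Each i >= 1 lies on exactly one chain c, c l, c l^2, ... with l not dividing
   c, and the constraint defining the multiplicative subshift only relates the
   coordinates along a chain.  If M has a divisor d > |u| coprime to l, then no
   multiple of M lies on a chain meeting [1, |u|]; so u and the copy of v placed
   at the multiples of |u| M can be prescribed independently.  On a chain not
   meeting [1, |u|] the copy of v asks for a prefix of a point of Omega at some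
   delayed position, which is exactly what extensibility provides.  Conversely,
   spelling a word of Omega along the powers of l and using a first word of
   length l^m forces any word of Omega to appear in Omega with delay m. *)
Require Import Defs.
From mathcomp Require Import all_boot.
From mathcomp Require Import all_classical.
From mathcomp Require Import topology.

Set Implicit Arguments.
Unset Strict Implicit.
Unset Printing Implicit Defensive.

Local Open Scope classical_set_scope.

Lemma restrE (A : Type) (x : nat -> A) m n :
  restr x m.+1 (m + n) = mkseq (fun t => x (m + t)) n.
Proof.
rewrite /restr /index_iota subSS addKn /mkseq -[m.+1]addn0 iotaDl -map_comp.
by apply: eq_map => t.
Qed.

Lemma size_restr1 (A : Type) (x : nat -> A) n : size (restr x 1 n) = n.
Proof. by rewrite (restrE x 0) size_mkseq. Qed.

Lemma eq_mkseqP (A : Type) (f g : nat -> A) n :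
  mkseq f n = mkseq g n <-> (forall t, t < n -> f t = g t).
Proof.
split=> [E t tn|E]; last first.
  rewrite /mkseq; elim: n E => // n IH E.
  rewrite -addn1 iotaD !map_cat /= add0n E // IH // => t tn.
  by apply: E; apply: ltnW.
by rewrite -(nth_mkseq (f 0) f tn) E nth_mkseq.
Qed.

Lemma eq_restr1P (A : Type) (x y : nat -> A) n :
  restr x 1 n = restr y 1 n <->
  (forall k, 0 < k <= n -> coord x k = coord y k).
Proof.
rewrite !(restrE _ 0) eq_mkseqP; split=> E.
  by case=> // k /andP[_ kn]; exact: (E k).
by move=> t tn; exact: (E t.+1).
Qed.

Lemma iter_shift (A : Type) (Omega : set (nat -> A)) x n :
  (@shift A) @` Omega `<=` Omega -> Omega x -> Omega (fun t => x (n + t)).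
Proof.
move=> sh Ox; elim: n => [//|n IH].
by have := sh _ (imageP (@shift A) IH); congr Omega; apply/funext => t;
  rewrite /shift /family1 /coord /= addnS.
Qed.

(** Shift invariance moves any occurrence of a word to the start of a point, so only prefixes of
    points need to be delayed. The cases [m = 0] and [n = 0], absent from [extensible], hold with
    [z = y]. *)
Lemma extensibleP (A : Type) (Omega : set (nat -> A)) :
  (@shift A) @` Omega `<=` Omega ->
  extensible Omega <->
  (forall y m n, Omega y ->
     exists2 z, Omega z & forall t, t < n -> z (m + t) = y t).
Proof.
move=> sh; split=> [ext y [|m] n Oy|ext u m]; first by exists y.
- case: n => [|n]; first by exists y.
  have [||z Oz] := ext (restr y 1 n.+1) m.+1 => //.
    split; first by rewrite size_restr1.
    by exists y, 1; split; rewrite // size_restr1.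
  rewrite size_restr1 restrE (restrE y 0) => /eq_mkseqP E.
  by exists z.
- case=> u1 [x [[|i] [Ox // _]]]; rewrite addSn /= restrE => uE _.
  have [z Oz E] := ext _ m (size u) (iter_shift i sh Ox).
  exists z => //; rewrite restrE -[RHS]uE.
  exact/eq_mkseqP.
Qed.

Lemma mult_subshiftE (A : Type) (Omega : set (nat -> A)) l x :
  mult_subshift Omega l x <->
  (forall i, 0 < i -> Omega (fun j => coord x (i * l ^ j))).
Proof.
split=> h i i0; have := h i i0; congr Omega; apply/funext => j;
  by rewrite /family1 subn1.
Qed.

(** [root k] is [k] stripped of all its factors [l] and [val k] counts them; [l] may be composite.
    The last clause comes from uniqueness of this decomposition. *)
Lemma chain_decomposition l : 1 < l ->
  exists root val : nat -> nat, forall k, 0 < k ->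
    [/\ 0 < root k, k = root k * l ^ val k &
        forall n, root (k * l ^ n) = root k /\ val (k * l ^ n) = val k + n].
Proof.
move=> l1; have l0 := ltnW l1.
have dec k : exists ce, 0 < k -> ~~ (l %| ce.1) /\ k = ce.1 * l ^ ce.2.
  elim/ltn_ind: k => k IH; case: (posnP k) => [->|k0]; first by exists (0, 0).
  have [/dvdnP[q kE]|ndv] := boolP (l %| k); last first.
    by exists (k, 0) => _; rewrite muln1.
  have q0 : 0 < q by move: k0; rewrite kE muln_gt0 => /andP[].
  have [|[c e] /= ce] := IH q; first by rewrite kE ltn_Pmulr.
  have [nc qE] := ce q0; exists (c, e.+1) => _ /=.
  by rewrite kE {1}qE expnSr mulnA.
(* A larger exponent on the right would make [l] divide [c]. Applied in both directions, this makes
   the exponents equal. *)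
have le_exp c c' e e' : ~~ (l %| c) -> c * l ^ e = c' * l ^ e' -> e' <= e.
  move=> nc E; rewrite leqNgt; apply: contra nc => /subnK ee'.
  move: E; rewrite -ee' expnD expnS !mulnA => /eqP.
  by rewrite eqn_pmul2r ?expn_gt0 ?l0 // => /eqP ->; exact: dvdn_mull.
have [f fP] := choice dec.
exists (fun k => (f k).1), (fun k => (f k).2) => k k0.
have [nr kE] := fP k k0; split=> // [|n].
  by case: posnP nr => // ->; rewrite dvdn0.
have kn0 : 0 < k * l ^ n by rewrite muln_gt0 k0 expn_gt0 l0.
have [nr' knE] := fP _ kn0.
have E : (f (k * l ^ n)).1 * l ^ (f (k * l ^ n)).2 = (f k).1 * l ^ ((f k).2 + n).
  by rewrite -knE {1}kE expnD mulnA.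
have vE : (f (k * l ^ n)).2 = (f k).2 + n.
  by apply/eqP; rewrite eqn_leq (le_exp _ _ _ _ nr' E) (le_exp _ _ _ _ nr (esym E)).
split=> //; apply/eqP.
by rewrite -(@eqn_pmul2r (l ^ ((f k).2 + n))) ?expn_gt0 ?l0 // -E vE.
Qed.

(** Chains partition the positive integers, so a point of the multiplicative subshift amounts to an
    independent choice of a point of [Omega] on each chain; [P] carries the values to be
    prescribed. *)
Lemma mult_subshift_glue (A : Type) (Omega : set (nat -> A)) l
    (P : nat -> A -> Prop) :
  (@shift A) @` Omega `<=` Omega -> 1 < l ->
  (forall c, 0 < c ->
     exists2 y, Omega y & forall j, P (c * l ^ j) (y j)) ->
  exists2 x, mult_subshift Omega l x & forall k, 0 < k -> P k (coord x k).
Proof.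
move=> sh l1 ex.
have [root [val rv]] := chain_decomposition l1.
have exY c : exists y, 0 < c -> Omega y /\ forall j, P (c * l ^ j) (y j).
  case: (posnP c) => [->|c0]; first by case: (ex 1 isT) => y; exists y.
  by case: (ex c c0) => y Oy Py; exists y.
have [Y YP] := choice exY.
exists (family1 (fun k => Y (root k) (val k))).
(* The progression starting at [i] reads the point chosen for [root i] from index [val i] on, hence
   a shift of it. *)
- apply/mult_subshiftE => i i0; have [r0 _ rvi] := rv i i0.
  have [OY _] := YP _ r0; have := iter_shift (val i) sh OY.
  congr Omega; apply/funext => j; rewrite /coord /family1 prednK.
    by have [-> ->] := rvi j.
  by rewrite muln_gt0 i0 expn_gt0 ltnW.
- move=> k k0; have [r0 kE _] := rv k k0; have [_ PY] := YP _ r0.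
  by rewrite /coord /family1 prednK // {1}kE.
Qed.

Lemma coprime_multiple_avoids_chain l d c j N :
  coprime d l -> 0 < c < d -> d %| N -> N <> c * l ^ j.
Proof.
move=> dl /andP[c0 cd] dN NE; move: dN; rewrite NE Gauss_dvdl ?coprimeXr //.
by move=> /(dvdn_leq c0); rewrite leqNgt cd.
Qed.

(** Common source of transitivity and of both mixing properties: these differ only in the multiplier
    [M] and in the divisor [d] that keeps the two words on disjoint chains. *)
Lemma extensible_joint_word (A : Type) (Omega : set (nat -> A)) l d M u v :
  (@shift A) @` Omega `<=` Omega -> 1 < l -> extensible Omega ->
  mult_admissible (mult_subshift Omega l) u ->
  mult_admissible (mult_subshift Omega l) v ->
  coprime d l -> size u < d -> d %| M -> 0 < M ->
  exists x, [/\ mult_subshift Omega l x, restr x 1 (size u) = u &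
                restr (Pi (size u * M) x) 1 (size v) = v].
Proof.
move=> sh l1 /(extensibleP sh) ext [x0 [n [X0 n1 ->]]] [x1 [r [X1 r1 ->]]].
rewrite !size_restr1 => dl nd dM M0.
have l0 := ltnW l1.
have X0c := (mult_subshiftE _ _ _).1 X0; have X1c := (mult_subshiftE _ _ _).1 X1.
have nM0 : 0 < n * M by rewrite muln_gt0 n1.
have dnM q : d %| n * M * q by rewrite dvdn_mulr // dvdn_mull.
pose P k a := (k <= n -> a = coord x0 k) /\
  forall q, 0 < q <= r -> k = n * M * q -> a = coord x1 q.
have [|x Xx Px] := @mult_subshift_glue A Omega l P sh l1; last first.
  exists x; split=> //; apply/eq_restr1P => k /andP[k0 kn].
    by have [->] := Px k k0.
  rewrite /Pi {1}/coord /family1 prednK //.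
  have [] := Px (n * M * k); first by rewrite muln_gt0 nM0.
  by move=> _; apply; rewrite // k0.
(* A chain starting at [c <= n < d] contains no multiple of [d], hence no position of [v]: the
   values of [x0] serve. *)
move=> c c0; have [cn|nc] := leqP c n.
  exists (fun j => coord x0 (c * l ^ j)); first exact: X0c.
  move=> j; split=> // q _ E.
  have cd : 0 < c < d by rewrite c0 (leq_ltn_trans cn).
  by have := coprime_multiple_avoids_chain dl cd (dnM q) (esym E).
(* Past [n] the word [u] asks for nothing. If the chain also misses the multiples of [n * M], [x0]
   is a mere filler. *)
have [exb|nexb] := pselect (exists b, n * M %| c * l ^ b); last first.
  exists (fun j => coord x0 (c * l ^ j)); first exact: X0c.
  by move=> j; split=> // q _ E; case: nexb; exists j; rewrite E dvdn_mulr.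
(* From the first index [b] with [c * l ^ b = q0 * (n * M)] on, [v] asks for the chain of [x1] at
   [q0], delayed by [b]. *)
case: (ex_minnP exb) => b /dvdnP[q0 q0E] bmin.
have q00 : 0 < q0.
  have: 0 < c * l ^ b by rewrite muln_gt0 c0 expn_gt0 l0.
  by rewrite q0E muln_gt0 => /andP[].
have [z Oz zE] := ext _ b r (X1c q0 q00).
exists z => // j; split=> [cjn|q /andP[_ qr] E].
  suff: c <= n by rewrite leqNgt nc.
  by apply: leq_trans cjn; rewrite leq_pmulr // expn_gt0 l0.
have bj : b <= j by apply: bmin; rewrite E dvdn_mulr.
have qE : q = q0 * l ^ (j - b).
  apply/eqP; rewrite -(eqn_pmul2l nM0) -E mulnA [n * M * q0]mulnC -q0E.
  by rewrite -mulnA -expnD subnKC.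
rewrite -{1}(subnKC bj) zE -?qE //.
(* With [t = j - b], [t < l ^ t <= q <= r], so the [r] terms copied into [z] suffice. *)
apply: leq_trans (ltn_expl _ l1) (leq_trans _ qr).
by rewrite qE leq_pmull.
Qed.

Lemma transitive_extensible (A : Type) (Omega : set (nat -> A)) l :
  (@shift A) @` Omega `<=` Omega -> 1 < l ->
  mult_transitive (mult_subshift Omega l) -> extensible Omega.
Proof.
move=> sh l1 tr; have l0 := ltnW l1; apply/(extensibleP sh) => y m n Oy.
have [|x Xx xE] := @mult_subshift_glue A Omega l
    (fun k a => forall j, k = l ^ j -> a = y j) sh l1.
  (* A chain started at [l ^ e] must carry [y] from index [e] on; one started elsewhere never meets
     a power of [l]. *)
  move=> c c0; have [[e cE]|ne] := pselect (exists e, c = l ^ e).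
    exists (fun t => y (e + t)); first exact: (iter_shift e sh Oy).
    move=> t j; rewrite cE -expnD => /eqP.
    by rewrite eqn_exp2l // => /eqP ->.
  exists y => // t j E; case: ne; exists (j - t).
  have tj : t <= j by rewrite -(leq_exp2l _ _ l1) -E leq_pmull.
  apply/eqP; rewrite -(@eqn_pmul2r (l ^ t)) ?expn_gt0 ?l0 //.
  by rewrite E -expnD subnK.
have adm k : 0 < k -> mult_admissible (mult_subshift Omega l) (restr x 1 k).
  by move=> k0; exists x, k.
have pow0 k : 0 < l ^ k by rewrite expn_gt0 l0.
have [M [z [M0 Xz _]]] := tr _ _ (adm _ (pow0 m)) (adm _ (pow0 n)).
rewrite !size_restr1 => /eq_restr1P zE.
(* Since [l ^ m * M * l ^ t = M * l ^ (m + t)], the chain of [z] at [M] shows [y t] at index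
   [m + t]. *)
exists (fun j => coord z (M * l ^ j)); first exact: (mult_subshiftE _ _ _).1.
move=> t tn; rewrite -(xE (l ^ t)) // -zE; last first.
  by rewrite pow0 leq_exp2l // ltnW.
by rewrite /Pi {2}/coord /family1 prednK // expnD mulnCA mulnA.
Qed.

Theorem theorem1p1 (A : finType) (Omega : set (nat -> A)) (l : nat)
    (hOmega : shift_space Omega) (hl : (2 <= l)%N) :
  let X := mult_subshift Omega l in
  [<-> extensible Omega;
       mult_transitive X;
       forall u v, mult_admissible X u -> mult_admissible X v ->
         exists alpha, [/\ (1 <= alpha)%N, ~~ (l %| alpha) &
           forall k : nat, exists x, [/\ X x, restr x 1 (size u) = u &
             restr (Pi (size u * alpha * l ^ k) x) 1 (size v) = v]];
       exists L, [/\ (1 < L)%N,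
         (exists p, [/\ prime p, p %| L & ~~ (p %| l)]) &
         directional_mixing X L];
       forall L, (1 < L)%N ->
         (exists p, [/\ prime p, p %| L & ~~ (p %| l)]) ->
         directional_mixing X L].
Proof.
move=> X; have [_ sh] := hOmega; have l0 := ltnW hl.
have trans_ext : mult_transitive X -> extensible Omega.
  exact: transitive_extensible.
have large_prime n : exists p, [/\ prime p, n < p & coprime p l].
  have [p pn pp] := prime_above (n + l); exists p; split=> //.
    exact: leq_ltn_trans (leq_addr _ _) pn.
  rewrite prime_coprime //; apply/negP => /(dvdn_leq l0).
  by rewrite leqNgt (leq_ltn_trans (leq_addl _ _) pn).
have ext_mixing : extensible Omega -> forall L, (1 < L)%N ->
    (exists p, [/\ prime p, p %| L & ~~ (p %| l)]) -> directional_mixing X L.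
  (* The exponent [k = size u] works for every [alpha]: [p ^ size u] exceeds [size u], is coprime to
     [l] and divides [L ^ size u]. *)
  move=> ext L L1 [p [pp pL pl]] u v Xu Xv; exists (size u) => alpha a0 _.
  rewrite -mulnA; apply: (extensible_joint_word (d := p ^ size u)) => //.
  - by rewrite coprimeXl // prime_coprime.
  - exact: ltn_expl (prime_gt1 pp).
  - by rewrite dvdn_mull // dvdn_exp2r.
  - by rewrite muln_gt0 a0 expn_gt0 ltnW.
(* The implications form a cycle. Properties (3), (4) and (5) give back extensibility through
   transitivity, by taking [k = 0] in (3) and [alpha = 1], not divisible by [L > 1], in (4) and
   (5). *)
tfae.
- move=> ext u v Xu Xv; have [p [pp up pl]] := large_prime (size u).
  have [x [Xx xu xv]] :=
    extensible_joint_word sh hl ext Xu Xv pl up (dvdnn p) (prime_gt0 pp).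
  by exists p, x; split=> //; exact: prime_gt0.
- move=> /trans_ext ext u v Xu Xv; have [p [pp up pl]] := large_prime (size u).
  (* The prime [p] divides [p * l ^ k] for all [k], so one [alpha = p] serves them all. *)
  exists p; split; first exact: prime_gt0.
    apply/negP => lp; move: pl; rewrite coprime_sym /coprime.
    by move/gcdn_idPl: lp => ->; rewrite gtn_eqF.
  move=> k; rewrite -mulnA; apply: (extensible_joint_word (d := p)) => //.
  + exact: dvdn_mulr.
  + by rewrite muln_gt0 prime_gt0 // expn_gt0 l0.
- move=> H; have [p [pp lp pl]] := large_prime l.
  have Lp : exists p0, [/\ prime p0, p0 %| p & ~~ (p0 %| l)].
    by exists p; rewrite -prime_coprime.
  exists p; split=> //; first exact: prime_gt1.
  apply: ext_mixing (prime_gt1 pp) Lp; apply: trans_ext => u v Xu Xv.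
  have [alpha [a0 _ /(_ 0) [x]]] := H u v Xu Xv.
  by rewrite muln1 => -[Xx xu xv]; exists alpha, x.
- move=> [L [L1 Lp mix]]; apply: ext_mixing; apply: trans_ext => u v Xu Xv.
  have [k /(_ 1 isT) [|x]] := mix u v Xu Xv; first by rewrite dvdn1 gtn_eqF.
  rewrite muln1 => -[Xx xu xv]; exists (L ^ k), x.
  by split=> //; rewrite expn_gt0 ltnW.
- move=> H; have [p [pp lp pl]] := large_prime l.
  apply: trans_ext => u v Xu Xv.
  have [||k /(_ 1 isT) [|x]] := H p _ _ u v Xu Xv.
  + exact: prime_gt1.
  + by exists p; rewrite -prime_coprime.
  + by rewrite dvdn1 gtn_eqF // prime_gt1.
  rewrite muln1 => -[Xx xu xv]; exists (p ^ k), x.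
  by split=> //; rewrite expn_gt0 prime_gt0.
Qed.
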